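(* The matrices $\Phi$ and $\Psi$ are symmetric.
   Context: Let $\Gamma=(X,R)$ be a finite, undirected, connected, distance-regular graph without loops or multiple edges, with path-length distance $\partial$ and diameter $D\ge3$, intersection numbers $c_i,b_i$. Fix $b,\beta\in\mathbb C$ with $b\ne1$ and assume $\Gamma$ has classical parameters $(D,b,\alpha,\beta)$ with $\alpha=b-1$, i.e. $c_i=b^{i-1}\frac{b^i-1}{b-1}$, $b_i=(\beta+1-b^i)\frac{b^D-b^i}{b-1}$ ($0\le i\le D$). Fix $q\in\mathbb C$ with $q^2=b$. Let $E_0,\dots,E_D$ be the primitive idempotents of the Bose–Mesner algebra ordered so that Krein parameters equal intersection numbers ($q^h_{ij}=p^h_{ij}$); $\Gamma$ is $Q$-polynomial with respect to this ordering. Let $V=\mathbb C X$ with Hermitian form $\langle u,v\rangle=u^t\overline v$. Fix a vertex $x$ and let $E^*_i$ be the diagonal matrix with $(y,y)$-entry $1$ if $\partial(x,y)=i$, else $0$. For $-1\le i,j\le D$ define $V^{\downarrow\downarrow}_{i,j}=(E^*_0V+\dots+E^*_iV)\cap(E_0V+\dots+E_jV)$ and $V^{\downarrow\uparrow}_{i,j}=(E^*_0V+\dots+E^*_iV)\cap(E_DV+\dots+E_{D-j}V)$ (zero if $i=-1$ or $j=-1$). For $\mu\nu\in\{\downarrow\downarrow,\downarrow\uparrow\}$ and $0\le i,j\le D$ let $\tilde V^{\mu\nu}_{i,j}$ be the orthogonal complement of $V^{\mu\nu}_{i-1,j}+V^{\mu\nu}_{i,j-1}$ in $V^{\mu\nu}_{i,j}$;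 then $V=\bigoplus_{i,j}\tilde V^{\mu\nu}_{i,j}$ (direct sum). Define $\Phi,\Psi\in\mathrm{Mat}_X(\mathbb C)$ as the unique matrices such that for all $0\le i,j\le D$, $\Phi$ acts as $q^{i+j-D}I$ on $\tilde V^{\downarrow\downarrow}_{i,j}$ and $\Psi$ acts as $q^{i+j-D}I$ on $\tilde V^{\downarrow\uparrow}_{i,j}$. *)

(* Defs.v *)
From HB Require Import structures.
From mathcomp Require Import all_boot all_order all_algebra.
From mathcomp Require Import complex reals.

Set Implicit Arguments.
Unset Strict Implicit.
Unset Printing Implicit Defensive.
Import Order.TTheory GRing.Theory Num.Theory.
Local Open Scope ring_scope.

Section Graph.
Variables (X : finType) (e : rel X).

Definition simple_graph : Prop := symmetric e /\ irreflexive e.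

Definition connected_graph : Prop := forall x y : X, connect e x y.

Definition has_walk (x y : X) (n : nat) : bool :=
  [exists p : n.-tuple X, path e x p && (last x p == y)].

(* A shortest walk repeats no vertex, so has length < #|X|; the value is #|X|
   when y cannot be reached from x. *)
Definition dist (x y : X) : nat := find (has_walk x y) (iota 0 #|X|).

Definition diameter : nat := (\max_(x : X) \max_(y : X) dist x y)%N.

Definition nb_between (i j : nat) (x y : X) : nat :=
  #|[set z | (dist x z == i) && (dist z y == j)]|.

Definition distance_regular : Prop :=
  forall (h i j : nat) (x y x' y' : X),
    dist x y = h -> dist x' y' = h -> nb_between i j x y = nb_between i j x' y'.

(* p^h_{ij}; in a distance-regular graph the chosen pair is irrelevant. *)
Definition intersection_number (h i j : nat) : nat :=
  if [pick xy : X * X | dist xy.1 xy.2 == h] is Some xy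
  then nb_between i j xy.1 xy.2 else 0%N.

(* c_0 = 0 and b_D = 0, because p^0_{10} = 0 and p^D_{1,D+1} = 0. *)
Definition c_ (i : nat) : nat := intersection_number i 1 i.-1.
Definition b_ (i : nat) : nat := intersection_number i 1 i.+1.

End Graph.

Section ClassicalParameters.
Variables (X : finType) (e : rel X) (C : fieldType).

Definition gauss (b : C) (i : nat) : C := \sum_(k < i) b ^+ k.

(* For i = 0 the truncated i.-1 is harmless, since gauss b 0 = 0. *)
Definition classical_parameters (D : nat) (b alpha beta : C) : Prop :=
  D = diameter e /\
  forall i : nat, (i <= D)%N ->
    (c_ e i)%:R = gauss b i * (1 + alpha * gauss b i.-1) /\
    (b_ e i)%:R = (gauss b D - gauss b i) * (beta - alpha * gauss b i).

Lemma gaussE (b : C) (i : nat) : b != 1 -> gauss b i = (b ^+ i - 1) / (b - 1).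
Proof.
move=> b1; have b1' : b - 1 != 0 by rewrite subr_eq0.
by apply: (mulfI b1'); rewrite -subrX1 [RHS]mulrC divfK.
Qed.

Lemma classical_parameters_subr1 (D : nat) (b beta : C) : b != 1 ->
  classical_parameters D b (b - 1) beta <->
  D = diameter e /\
  forall i : nat, (i <= D)%N ->
    (c_ e i)%:R = b ^ (i%:Z - 1) * ((b ^+ i - 1) / (b - 1)) /\
    (b_ e i)%:R = (beta + 1 - b ^+ i) * ((b ^+ D - b ^+ i) / (b - 1)).
Proof.
move=> b1; have b1' : b - 1 != 0 by rewrite subr_eq0.
have g i : (b - 1) * gauss b i = b ^+ i - 1.
  by rewrite gaussE // mulrC divfK.
have Ec i : gauss b i * (1 + (b - 1) * gauss b i.-1)
            = b ^ (i%:Z - 1) * ((b ^+ i - 1) / (b - 1)).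
  rewrite g addrC subrK -gaussE // mulrC.
  case: i => [|i]; first by rewrite /gauss big_ord0 !mulr0.
  by have -> : i.+1%:Z - 1 = i%:Z by rewrite -addn1 PoszD addrK.
have Eb i : (gauss b D - gauss b i) * (beta - (b - 1) * gauss b i)
            = (beta + 1 - b ^+ i) * ((b ^+ D - b ^+ i) / (b - 1)).
  by rewrite g !gaussE // -mulrBl mulrC !opprB addrA [X in _ * (X / _)]addrA subrK.
by split=> -[DE H]; split=> // i /H; rewrite Ec Eb.
Qed.

End ClassicalParameters.

(* Mat_X(C) is 'M[C]_#|X| and V = CX is 'cV[C]_#|X|; the coordinate k stands for
   the vertex enum_val k. *)
Section BoseMesner.
Variables (X : finType) (e : rel X) (C : numClosedFieldType).

Definition dist_mx (i : nat) : 'M[C]_#|X| :=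
  \matrix_(k, l) (dist e (enum_val k) (enum_val l) == i)%:R.

Definition bose_mesner : {vspace 'M[C]_#|X|} :=
  (\sum_(i < (diameter e).+1) <[dist_mx i]>)%VS.

Definition primitive_idempotent (M : 'M[C]_#|X|) : Prop :=
  [/\ M \in bose_mesner, M *m M = M, M != 0 &
      forall F : 'M[C]_#|X|, F \in bose_mesner -> F *m F = F ->
        M *m F = F -> F *m M = F -> F = 0 \/ F = M].

Definition primitive_idempotent_ordering
    (E : 'I_(diameter e).+1 -> 'M[C]_#|X|) : Prop :=
  [/\ injective E, forall i, primitive_idempotent (E i) &
      forall M, primitive_idempotent M -> exists i, M = E i].

(* The entrywise product of E_i and E_j equals |X|^-1 sum_h q^h_{ij} E_h. *)
Definition krein_parameters (E : 'I_(diameter e).+1 -> 'M[C]_#|X|)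
    (kr : 'I_(diameter e).+1 -> 'I_(diameter e).+1 -> 'I_(diameter e).+1 -> C) :
    Prop :=
  forall i j, map2_mx *%R (E i) (E j) = #|X|%:R^-1 *: \sum_h kr h i j *: E h.

Definition Estar (x : X) (i : nat) : 'M[C]_#|X| :=
  \matrix_(k, l) ((k == l) && (dist e x (enum_val k) == i))%:R.

Definition mximage (M : 'M[C]_#|X|) : {vspace 'cV[C]_#|X|} :=
  limg (linfun (mulmx M : 'cV[C]_#|X| -> 'cV[C]_#|X|)).

Definition herm (u v : 'cV[C]_#|X|) : C := (u^T *m map_mx Num.conj v) 0 0.

Variables (x : X) (E : 'I_(diameter e).+1 -> 'M[C]_#|X|).

(* The indices are integers, so that -1 gives an empty sum. *)
Definition Vdd (i j : int) : {vspace 'cV[C]_#|X|} :=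
  ((\sum_(h < (diameter e).+1 | (h%:Z <= i)%R) mximage (Estar x h)) :&:
   (\sum_(h < (diameter e).+1 | (h%:Z <= j)%R) mximage (E h)))%VS.

Definition Vdu (i j : int) : {vspace 'cV[C]_#|X|} :=
  ((\sum_(h < (diameter e).+1 | (h%:Z <= i)%R) mximage (Estar x h)) :&:
   (\sum_(h < (diameter e).+1 | ((diameter e)%:Z - j <= h%:Z)%R)
      mximage (E h)))%VS.

Definition in_split (W : int -> int -> {vspace 'cV[C]_#|X|}) (i j : int)
    (v : 'cV[C]_#|X|) : Prop :=
  v \in W i j /\
  forall u, u \in (W (i - 1)%R j + W i (j - 1)%R)%VS -> herm v u = 0.

Definition acts_on_split (W : int -> int -> {vspace 'cV[C]_#|X|}) (q : C)
    (M : 'M[C]_#|X|) : Prop :=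
  forall (i j : 'I_(diameter e).+1) (v : 'cV[C]_#|X|),
    in_split W i%:Z j%:Z v ->
    M *m v = q ^ (i%:Z + j%:Z - (diameter e)%:Z) *: v.

End BoseMesner.

(* Main.v *)
Require Import Defs.
From HB Require Import structures.
From mathcomp Require Import all_boot all_order all_algebra.
From mathcomp Require Import complex reals.
From mathcomp Require Import zify ring.
Set Implicit Arguments.
Unset Strict Implicit.
Unset Printing Implicit Defensive.
Import Order.TTheory GRing.Theory Num.Theory.
Local Open Scope ring_scope.

(** Let [A] be the adjacency matrix, [A*] the dual adjacency matrix with respect
    to [x], and [V_{i,j}] either family of split subspaces. With [theta_j] and
    [theta*_i] the corresponding eigenvalues, [A - theta_j] maps [V_{i,j}] into
    [V_{i+1,j-1}] and [A* - theta*_i] maps it into [V_{i-1,j+1}]. So [S_k], the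
    sum of the [V_{i,j}] with [i + j = k], is stable under [A] and [A*], hence,
    with its orthogonal complement, under all [E_j] and [E*_i]. This forces the
    (i,j) summand of the split decomposition to be orthogonal to [S_k] for
    [k < i + j].
    So the eigenspaces of [Phi] and [Psi] are mutually orthogonal; as they are
    also closed under complex conjugation, both matrices are symmetric. *)

(** * Path-length distance and vanishing of intersection numbers *)

Section Distance.
Variables (X : finType) (e : rel X).

Lemma has_walkP (x y : X) (n : nat) :
  reflect (exists p, [/\ size p = n, path e x p & last x p = y])
          (has_walk e x y n).
Proof.
apply: (iffP existsP) => [[p /andP[ep /eqP lp]]|[p [sp ep lp]]].
  by exists p; rewrite size_tuple.
by exists (tcast sp (in_tuple p)); rewrite val_tcast ep lp eqxx.
Qed.

(** If [n] were below the index returned by [find], it would also be below [#|X|], hence a searched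
    length that [find] rejected. *)
Lemma dist_le_walk (x y : X) (n : nat) :
  has_walk e x y n -> (dist e x y <= n)%N.
Proof.
move=> xyn; rewrite leqNgt; apply/negP => lt_n.
have ltX : (n < #|X|)%N.
  by apply: leq_trans lt_n _; rewrite -[leqRHS](size_iota 0) find_size.
by have := before_find 0%N lt_n; rewrite nth_iota // add0n xyn.
Qed.

Lemma distxx (x : X) : dist e x x = 0%N.
Proof.
by apply/eqP; rewrite -leqn0; apply: dist_le_walk; apply/has_walkP; exists [::].
Qed.

Lemma dist_le_diameter (x y : X) : (dist e x y <= diameter e)%N.
Proof.
apply: leq_trans (leq_bigmax x); exact: (leq_bigmax (F := fun y => dist e x y)).
Qed.

Hypothesis e_conn : connected_graph e.

(** A connecting walk can be shortened to one without repeated vertices, whose length is below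
    [#|X|], so the search in [dist] succeeds. *)
Lemma dist_walk (x y : X) : has_walk e x y (dist e x y).
Proof.
have hw : has (has_walk e x y) (iota 0 #|X|).
  have /connectP[p ep ->] := e_conn x y.
  case/shortenP: ep => p' ep' up' _; apply/hasP; exists (size p').
    rewrite mem_iota /= add0n.
    by rewrite -[leqLHS]/(size (x :: p')) -(card_uniqP up') max_card.
  by apply/has_walkP; exists p'.
have := nth_find 0%N hw; rewrite nth_iota ?add0n //.
by rewrite -[ltnRHS](size_iota 0) -has_find.
Qed.

Lemma dist_eq0 (x y : X) : (dist e x y == 0%N) = (x == y).
Proof.
apply/eqP/eqP => [d0|->]; last exact: distxx.
by have /has_walkP[p []] := dist_walk x y; rewrite d0; case: p.
Qed.

Lemma dist_triangle (x y z : X) : (dist e x z <= dist e x y + dist e y z)%N.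
Proof.
have /has_walkP[p [sp ep lp]] := dist_walk x y.
have /has_walkP[p' [sp' ep' lp']] := dist_walk y z.
apply: dist_le_walk; apply/has_walkP; exists (p ++ p').
by rewrite size_cat sp sp' cat_path ep lp ep' last_cat lp lp'.
Qed.

(** Cut a shortest walk after [i] steps: the two pieces bound the distances from above, and the
    triangle inequality turns both bounds into equalities. *)
Lemma dist_split (x y : X) (i j : nat) : dist e x y = (i + j)%N ->
  exists z, dist e x z = i /\ dist e z y = j.
Proof.
move=> dxy; have /has_walkP[p [sp ep lp]] := dist_walk x y.
have := ep; rewrite -(cat_take_drop i p) cat_path => /andP[e1 e2].
have lei : (dist e x (last x (take i p)) <= i)%N.
  apply: dist_le_walk; apply/has_walkP; exists (take i p); split=> //.
  by rewrite size_takel // sp dxy leq_addr.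
have lej : (dist e (last x (take i p)) y <= j)%N.
  apply: dist_le_walk; apply/has_walkP; exists (drop i p); split=> //.
    by rewrite size_drop sp dxy addKn.
  by rewrite -last_cat cat_take_drop.
have := dist_triangle x (last x (take i p)) y; rewrite dxy => le_tri.
exists (last x (take i p)); split; apply/eqP; rewrite eqn_leq ?lei ?lej /=.
  by rewrite -(leq_add2r j); apply: leq_trans le_tri _; rewrite leq_add2l.
by rewrite -(leq_add2l i); apply: leq_trans le_tri _; rewrite leq_add2r.
Qed.

Lemma dist_attained (x0 : X) (h : nat) : (h <= diameter e)%N ->
  exists x y, dist e x y = h.
Proof.
have Xgt0 : (0 < #|X|)%N by apply/card_gt0P; exists x0.
move=> leh.
have [x Dx] :=
  @bigop.eq_bigmax X (fun x => \max_(y : X) dist e x y)%N Xgt0.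
have [y Dy] := @bigop.eq_bigmax X (fun y => dist e x y) Xgt0.
have Dxy : dist e x y = (h + (diameter e - h))%N.
  by rewrite subnKC // /diameter Dx Dy.
by have [z [xz _]] := dist_split Dxy; exists x, z.
Qed.

Hypothesis e_sym : symmetric e.

Lemma dist_sym (x y : X) : dist e x y = dist e y x.
Proof.
have le_sym u v : (dist e u v <= dist e v u)%N.
  have /has_walkP[p [sp ep lp]] := dist_walk v u; subst u.
  apply: dist_le_walk; apply/has_walkP; exists (rev (belast v p)).
  rewrite size_rev size_belast rev_path.
  split=> //; first by rewrite (eq_path (e' := e)) // => a c; exact: e_sym.
  by case: p {sp ep} => //= a s; rewrite rev_cons last_rcons.
by apply/eqP; rewrite eqn_leq !le_sym.
Qed.

Hypothesis e_dr : distance_regular e.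

Lemma intersection_numberE (x y : X) (i j : nat) :
  intersection_number e (dist e x y) i j = nb_between e i j x y.
Proof.
rewrite /intersection_number; case: pickP => [[u v] /= /eqP duv|].
  exact: e_dr duv (erefl _).
by move=> /(_ (x, y)); rewrite eqxx.
Qed.

(** A vertex counted by p^h_{ij} would form a triangle with sides [h], [i], [j]. This vanishing is
    the source of every tridiagonal relation below. *)
Lemma intersection_number0 (h i j : nat) :
  ~~ [&& (h <= i + j)%N, (i <= h + j)%N & (j <= h + i)%N] ->
  intersection_number e h i j = 0%N.
Proof.
move=> tri; rewrite /intersection_number; case: pickP => [[x y] /= /eqP dxy|//].
apply/eqP; rewrite cards_eq0; apply/eqP/setP => z; rewrite !inE.
apply/negbTE; apply: contra tri => /andP[/eqP <- /eqP <-]; rewrite -dxy.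
apply/and3P; split; first exact: dist_triangle.
  by rewrite (dist_sym z y) dist_triangle.
by rewrite (dist_sym z y) [dist e x y]dist_sym dist_triangle.
Qed.

Lemma intersection_number_neq0 (x0 : X) (i j : nat) : (i + j <= diameter e)%N ->
  intersection_number e (i + j) i j != 0%N.
Proof.
move=> leD; have [x [y dxy]] := dist_attained x0 leD.
rewrite -dxy intersection_numberE -lt0n; apply/card_gt0P.
by have [z [xz zy]] := dist_split dxy; exists z; rewrite inE xz zy !eqxx.
Qed.

Lemma intersection_number_0l (x0 : X) (h j : nat) : (h <= diameter e)%N ->
  intersection_number e h 0 j = (h == j).
Proof.
move=> leD; have [x [y dxy]] := dist_attained x0 leD.
rewrite -dxy intersection_numberE /nb_between.
have -> : [set z | (dist e x z == 0%N) && (dist e z y == j)]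
        = if dist e x y == j then [set x] else set0.
  apply/setP => z; rewrite !inE dist_eq0 eq_sym.
  case: eqP => [->|ne]; case: ifP; rewrite !inE ?eqxx //=.
  by move/eqP: ne => /negbTE->.
by case: ifP; rewrite ?cards1 ?cards0.
Qed.

End Distance.

(** * The Hermitian form, orthogonal decomposition and stable subspaces *)

Section HermitianForm.
Variables (X : finType) (C : numClosedFieldType).
Implicit Types (u v w : 'cV[C]_#|X|) (S : {vspace 'cV[C]_#|X|}).

Lemma hermE u v : herm u v = \sum_k u k 0 * (v k 0)^*.
Proof. by rewrite /herm mxE; apply: eq_bigr => k _; rewrite !mxE. Qed.

Lemma hermC u v : herm v u = (herm u v)^*.
Proof.
rewrite !hermE rmorph_sum; apply: eq_bigr => k _.
by rewrite rmorphM /= conjCK mulrC.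
Qed.

Lemma hermDl u v w : herm (u + v) w = herm u w + herm v w.
Proof. by rewrite /herm linearD mulmxDl mxE. Qed.

Lemma hermZl (a : C) u w : herm (a *: u) w = a * herm u w.
Proof. by rewrite /herm linearZ -scalemxAl mxE. Qed.

Lemma herm0l w : herm 0 w = 0.
Proof. by rewrite -(scale0r (0 : 'cV_#|X|)) hermZl mul0r. Qed.

Lemma hermDr u v w : herm w (u + v) = herm w u + herm w v.
Proof. by rewrite hermC hermDl rmorphD /= -!hermC. Qed.

Lemma hermZr (a : C) u w : herm w (a *: u) = a^* * herm w u.
Proof. by rewrite hermC hermZl rmorphM /= -!hermC. Qed.

Lemma herm0r w : herm w 0 = 0.
Proof. by rewrite hermC herm0l conjC0. Qed.

Lemma hermv_eq0 v : (herm v v == 0) = (v == 0).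
Proof.
apply/eqP/eqP => [|->]; last exact: herm0l.
rewrite hermE => /psumr_eq0P v0; apply/colP => k; rewrite mxE; apply/eqP.
rewrite -(mul_conjC_eq0 (v k 0)) v0 // => i _; exact: mul_conjC_ge0.
Qed.

Definition orth S v : Prop := forall u, u \in S -> herm v u = 0.

Lemma orthD S u v : orth S u -> orth S v -> orth S (u + v).
Proof. by move=> Su Sv w Sw; rewrite hermDl Su // Sv // addr0. Qed.

Lemma orthZ S (a : C) u : orth S u -> orth S (a *: u).
Proof. by move=> Su w Sw; rewrite hermZl Su // mulr0. Qed.

Lemma orthS S T v : (S <= T)%VS -> orth T v -> orth S v.
Proof. by move=> /subvP sST Tv u /sST; apply: Tv. Qed.

Lemma orth_inter S v : v \in S -> orth S v -> v = 0.
Proof. by move=> Sv oSv; apply/eqP; rewrite -hermv_eq0 oSv. Qed.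

Lemma orth_addv S T v : orth S v -> orth T v -> orth (S + T)%VS v.
Proof.
move=> Sv Tv _ /memv_addP[s Ss [t Tt ->]].
by rewrite hermDr Sv // Tv // addr0.
Qed.

Lemma orth_decomp S v : exists s t : 'cV[C]_#|X|,
  [/\ v = s + t, s \in S & orth S t].
Proof.
rewrite -(span_basis (vbasisP S)).
elim: {S}(tval (vbasis S)) v => [|a l IH] v.
  exists 0, v; rewrite add0r span_nil mem0v; split=> // u.
  by rewrite memv0 => /eqP->; rewrite herm0r.
rewrite span_cons; have [s [t [-> ls ot]]] := IH v.
have [sa [ta [Da lsa lta]]] := IH a.
(* Gram-Schmidt: [ta] is the component of the new vector [a] orthogonal to the span of [l]. If it
   vanishes, [a] enlarges nothing; otherwise the projection of [t] on [ta] moves from [t] to [s]. *)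
have [ta0|ta_n0] := eqVneq ta 0.
  exists s, t; split=> //; first by rewrite (subvP (addvSr _ _)).
  apply: orth_addv (ot) => u /vlineP[c ->].
  by rewrite hermZr Da ta0 addr0 (ot _ lsa) mulr0.
have ha : herm ta ta != 0 by rewrite hermv_eq0.
pose c := herm t ta / herm ta ta.
exists (s + c *: ta), (t - c *: ta); split.
- by rewrite addrACA subrr addr0.
- have -> : s + c *: ta = c *: a + (s - c *: sa).
    by rewrite Da scalerDr [RHS]addrC addrA subrK.
  by apply: memv_add; rewrite ?memvB ?memvZ ?memv_line.
have olt : orth <<l>> (t - c *: ta) by rewrite -scaleNr; apply/orthD/orthZ.
apply: orth_addv => // u /vlineP[d ->].
rewrite hermZr Da hermDr (olt _ lsa) add0r -scaleNr hermDl hermZl mulNr.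
by rewrite divfK // subrr mulr0.
Qed.

Lemma orth_decomp_uniq S s s' t t' : s \in S -> s' \in S ->
  orth S t -> orth S t' -> s + t = s' + t' -> s = s' /\ t = t'.
Proof.
move=> Ss Ss' St St' E.
have D : s - s' = t' - t.
  by apply/eqP; rewrite subr_eq addrAC [t' + s']addrC -E addrK.
have t0 : t' - t = 0.
  apply: (@orth_inter S); first by rewrite -D memvB.
  by rewrite -scaleN1r; apply/orthD/orthZ.
by split; apply/eqP; rewrite -subr_eq0 ?D ?t0 // -oppr_eq0 opprB t0.
Qed.

(** Reality is expressed as invariance under conjugation. Both conditions together make [M]
    self-adjoint for [herm]; reality alone keeps the fixed space of [M] closed under conjugation. *)
Definition real_symmetric (M : 'M[C]_#|X|) : Prop :=
  M^T = M /\ map_mx Num.conj M = M.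

Lemma herm_adjoint M u v :
  real_symmetric M -> herm (M *m u) v = herm u (M *m v).
Proof.
by case=> Mt Mc; rewrite /herm trmx_mul Mt map_mxM Mc mulmxA.
Qed.

Definition stable (M : 'M[C]_#|X|) S : Prop :=
  forall v, v \in S -> M *m v \in S.

Lemma orth_stable M S v :
  real_symmetric M -> stable M S -> orth S v -> orth S (M *m v).
Proof. by move=> Mrs MS Sv u Su; rewrite herm_adjoint // Sv // MS. Qed.

(** [M] preserves both [S] and its orthogonal complement, so uniqueness of the decomposition
    applies. With [M] a projection, membership in its image passes to both components. *)
Lemma orth_decomp_fixed M S s t : real_symmetric M -> stable M S ->
  s \in S -> orth S t -> M *m (s + t) = s + t -> M *m s = s /\ M *m t = t.
Proof.
move=> Mrs MS Ss St; rewrite mulmxDr.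
by apply: orth_decomp_uniq (MS _ Ss) Ss (orth_stable Mrs MS St) St.
Qed.

End HermitianForm.

(** * Orthogonality of split parts lying on different antidiagonals *)

(* [XS i.+1] and [YS j.+1] are the sums of the first eigenspaces of [B] and [A],
   so that [W i.+1 j.+1] is the paper's V_{i,j}. *)
Section SplitDecomposition.
Variables (X : finType) (C : numClosedFieldType).
Variables (A B : 'M[C]_#|X|) (XS YS : nat -> {vspace 'cV[C]_#|X|}).
Variables (PX PY : nat -> 'M[C]_#|X|).
Implicit Types (u v w : 'cV[C]_#|X|) (S : {vspace 'cV[C]_#|X|}).

Hypothesis XS0 : XS 0 = 0%VS.
Hypothesis YS0 : YS 0 = 0%VS.
Hypothesis XSS : forall i, (XS i <= XS i.+1)%VS.
Hypothesis YSS : forall j, (YS j <= YS j.+1)%VS.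
Hypothesis PXP : forall i v, v \in XS i <-> PX i *m v = v.
Hypothesis PYP : forall j v, v \in YS j <-> PY j *m v = v.
Hypothesis PXrs : forall i, real_symmetric (PX i).
Hypothesis PYrs : forall j, real_symmetric (PY j).
Hypothesis raiseX : forall i v, v \in XS i -> A *m v \in XS i.+1.
Hypothesis raiseY : forall j v, v \in YS j -> B *m v \in YS j.+1.
Hypothesis lowerX :
  forall i, exists a, forall v, v \in XS i.+1 -> B *m v - a *: v \in XS i.
Hypothesis lowerY :
  forall j, exists a, forall v, v \in YS j.+1 -> A *m v - a *: v \in YS j.
(** Abstract form of the fact that the projections [PX i] are polynomials in [B], and the [PY j]
    polynomials in [A]. *)
Hypothesis stablePX : forall S, stable B S -> forall i, stable (PX i) S.
Hypothesis stablePY : forall S, stable A S -> forall j, stable (PY j) S.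

Let W (i j : nat) : {vspace 'cV[C]_#|X|} := (XS i :&: YS j)%VS.

(** Both indices of [W] are shifted by one, so this is the sum of the V_{i,j} with i + j = k - 2.
    The end terms [W 0 k] and [W k 0] vanish. *)
Let S (k : nat) : {vspace 'cV[C]_#|X|} := (\sum_(l < k.+1) W l (k - l))%VS.

Let leX i i' : (i <= i')%N -> (XS i <= XS i')%VS.
Proof.
move=> /subnKC <-; elim: (i' - i)%N => [|n IH]; rewrite ?addn0 //.
by rewrite addnS (subv_trans IH).
Qed.

Let leY j j' : (j <= j')%N -> (YS j <= YS j')%VS.
Proof.
move=> /subnKC <-; elim: (j' - j)%N => [|n IH]; rewrite ?addn0 //.
by rewrite addnS (subv_trans IH).
Qed.

Let leW i i' j j' : (i <= i')%N -> (j <= j')%N -> (W i j <= W i' j')%VS.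
Proof. by move=> /leX lei /leY lej; apply: capvS. Qed.

Let W_sub_S i j : (W i j <= S (i + j))%VS.
Proof.
have lt : (i < (i + j).+1)%N by rewrite ltnS leq_addr.
apply: (subv_trans _ (sumv_sup (Ordinal lt) isT (subvv _))).
by rewrite /= addKn.
Qed.


Let leS k : (S k <= S k.+1)%VS.
Proof.
apply/subv_sumP => l _; apply: (@subv_trans _ _ (W l (k.+1 - l))).
  by apply: leW; rewrite // leq_sub2r.
by have := W_sub_S l (k.+1 - l); rewrite subnKC // ltnW.
Qed.

Let W0l j v : v \in W 0 j -> v = 0.
Proof. by rewrite memv_cap XS0 memv0 => /andP[/eqP]. Qed.

Let W0r i v : v \in W i 0 -> v = 0.
Proof. by rewrite memv_cap YS0 memv0 => /andP[_ /eqP]. Qed.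

Let stableSP M k :
  (forall i j v, (i + j)%N = k -> v \in W i j -> M *m v \in S k) ->
  stable M (S k).
Proof.
move=> MW v /memv_sumP[w Ww ->]; rewrite mulmx_sumr; apply: memv_suml => l _.
by apply: MW (Ww l isT); rewrite subnKC // -ltnS.
Qed.

(** Subtracting a suitable scalar from [A] sends [W i j.+1] into [W i.+1 j], which lies on the same
    antidiagonal. *)
Let stableAS k : stable A (S k).
Proof.
apply: stableSP => i [|j] v <- Wv; first by rewrite (W0r Wv) mulmx0 mem0v.
have [a Aa] := lowerY j; rewrite -[A *m v](subrK (a *: v)).
apply: memvD; last by rewrite memvZ // (subvP (W_sub_S i j.+1)).
rewrite addnS -addSn.
apply: (subvP (W_sub_S i.+1 j)); move: Wv; rewrite !memv_cap => /andP[Xv Yv].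
by rewrite Aa // memvB ?raiseX ?memvZ // (subvP (XSS i)).
Qed.

Let stableBS k : stable B (S k).
Proof.
apply: stableSP => -[|i] j v <- Wv; first by rewrite (W0l Wv) mulmx0 mem0v.
have [a Ba] := lowerX i; rewrite -[B *m v](subrK (a *: v)).
apply: memvD; last by rewrite memvZ // (subvP (W_sub_S i.+1 j)).
rewrite addSn -addnS.
apply: (subvP (W_sub_S i j.+1)); move: Wv; rewrite !memv_cap => /andP[Xv Yv].
by rewrite Ba // memvB ?raiseY ?memvZ // (subvP (YSS j)).
Qed.

(** [S k] is stable under [B], hence under [PX i], whose fixed space is [XS i]. *)
Let decompX k i s t : s \in S k -> orth (S k) t -> s + t \in XS i ->
  s \in XS i /\ t \in XS i.
Proof.
move=> Ss St /PXP st; rewrite !PXP.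
exact: orth_decomp_fixed (PXrs i) (stablePX (@stableBS k) i) Ss St st.
Qed.

Let decompY k j s t : s \in S k -> orth (S k) t -> s + t \in YS j ->
  s \in YS j /\ t \in YS j.
Proof.
move=> Ss St /PYP st; rewrite !PYP.
exact: orth_decomp_fixed (PYrs j) (stablePY (@stableAS k) j) Ss St st.
Qed.

Let decompW k i j s t : s \in S k -> orth (S k) t -> s + t \in W i j ->
  s \in W i j /\ t \in W i j.
Proof.
move=> Ss St; rewrite !memv_cap => /andP[/(decompX Ss St)[-> ->]].
by move=> /(decompY Ss St)[-> ->].
Qed.

(* The component of [s] of largest index [n] lies in [W n.-1 (k.+1 - n)], hence
   in [S k], as soon as [i < n]; being orthogonal to [S k], it vanishes. *)
Let peel k i j n s : (k.+1 < i + j)%N -> (n <= k.+2)%N ->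
  s \in W i j -> orth (S k) s ->
  s \in (\sum_(l < n) W l (k.+1 - l) + S k)%VS ->
  s \in (W i.-1 j + W i j.-1)%VS.
Proof.
move=> lek; elim: n => [|n IH] len Ws os.
  by rewrite big_ord0 add0v => Ss; rewrite (orth_inter Ss os) mem0v.
rewrite big_ord_recr /= => /memv_addP[_ /memv_addP[u Uu [w Ww ->]] [z Sz Ds]].
have [a [c [Dw Sa oc]]] := orth_decomp (S k) w.
have [_ Wc] : a \in W n (k.+1 - n) /\ c \in W n (k.+1 - n).
  by apply: (decompW Sa oc); rewrite -Dw.
pose d := s - c.
have od : orth (S k) d by rewrite /d -scaleN1r; apply/orthD/orthZ.
have Dd : d = u + (a + z).
  by apply/eqP; rewrite subr_eq Ds Dw -!addrA [c + z]addrC.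
have Xu : u \in XS n.-1.
  move: Uu => /memv_sumP[f Wf ->]; apply: memv_suml => l _.
  have := Wf l isT; rewrite memv_cap => /andP[Xf _].
  by apply: subvP Xf; apply: leX; rewrite -ltnS (ltn_predK (ltn_ord l)).
(* [u] is the sum of [- (a + z)] in [S k] and [d] orthogonal to [S k], so [decompX] places [d] in
   the same [XS n.-1] as [u]. *)
have Xd : d \in XS n.-1.
  have Saz : - (a + z) \in S k by rewrite memvN memvD.
  by apply: (proj2 (decompX Saz od _)); rewrite Dd addrC addrK.
have Dsd : s = d + c by rewrite subrK.
move: (Ws) (Wc); rewrite !memv_cap => /andP[Xs Ys] /andP[Xc Yc].
have [lt_in|] := ltnP i n.
  have n_gt0 : (0 < n)%N by apply: leq_ltn_trans lt_in.
  have c0 : c = 0.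
    apply: orth_inter oc; have -> : k = (n.-1 + (k.+1 - n))%N.
      by case: (n) n_gt0 len => // m _ lem; rewrite subSS subnKC.
    apply: (subvP (W_sub_S _ _)); rewrite memv_cap Yc andbT.
    rewrite -[c](addKr d) -Dsd addrC memvB //.
    by apply: subvP Xs; apply: leX; rewrite -ltnS (ltn_predK lt_in).
  apply: IH => //; first exact: ltnW.
  by rewrite Dsd c0 addr0 Dd memv_add // memvD.
(* If [n = i], then [d] lies in [W i.-1 j] and [c] in [W i j.-1], because [k.+1 - n < j]. If
   [n < i], both lie in [XS i.-1], so [s] itself is in [W i.-1 j]. *)
rewrite leq_eqVlt => /predU1P[Dn|lt_ni].
  have le_j : (k.+1 - n <= j.-1)%N.
    have : (k.+1 - n < j)%N by rewrite ltn_subLR // Dn.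
    by case: (j).
  rewrite Dsd memv_add // memv_cap -?Dn ?Xd ?Xc /=.
    rewrite /d memvB // (subvP _ _ Yc) // leY //.
    by rewrite (leq_trans le_j) // leq_pred.
  by rewrite (subvP _ _ Yc) // leY.
apply: (subvP (addvSl _ _)); rewrite memv_cap Ys andbT Dsd.
have le_ni : (n <= i.-1)%N by case: (i) lt_ni.
rewrite memvD ?(subvP _ _ Xd) ?(subvP _ _ Xc) // leX //.
by rewrite (leq_trans (leq_pred _)).
Qed.

Let split_part i j v : Prop :=
  [/\ v \in W i j, orth (W i.-1 j) v & orth (W i j.-1) v].

(** Induction on [k]. The projection [s] of [v] on [S k.+1] stays in [W i j] and is orthogonal to
    [S k], so [peel] puts it in the sum to which [v] is orthogonal. Hence
    [herm s s = herm v s = 0]. *)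
Let split_orth_S i j v k : split_part i j v -> (k < i + j)%N -> orth (S k) v.
Proof.
case=> Wv o1 o2; elim: k => [|k IH] ltk.
  by move=> u; rewrite /S big_ord1 => /W0l->; rewrite herm0r.
have [s [t [Dv Ss ot]]] := orth_decomp (S k.+1) v.
have [Ws _] : s \in W i j /\ t \in W i j by apply: (decompW Ss ot); rewrite -Dv.
have os : orth (S k) s.
  have -> : s = v + (-1) *: t by rewrite scaleN1r Dv addrK.
  apply: orthD (IH (ltnW ltk)) _; apply: orthZ; exact: orthS (leS k) ot.
have s0 : s = 0.
  apply/eqP; rewrite -hermv_eq0.
  have -> : herm s s = herm v s by rewrite Dv hermDl (ot s Ss) addr0.
  apply/eqP; apply: (orth_addv o1 o2); apply: (peel ltk (leqnn _) Ws os).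
  by apply: (subvP (addvSl _ _)).
by rewrite Dv s0 add0r.
Qed.

(** The part with the larger index sum is orthogonal to the [S] that contains the other part. *)
Let split_orth i j r s u v : split_part i j u -> split_part r s v ->
  (i + j != r + s)%N -> herm u v = 0.
Proof.
move=> Pu Pv; have [[Wu _ _] [Wv _ _]] := (Pu, Pv).
rewrite neq_ltn => /orP[] lt.
  by rewrite hermC (split_orth_S Pv lt) ?conjC0 // (subvP (W_sub_S i j)).
by rewrite (split_orth_S Pu lt) // (subvP (W_sub_S r s)).
Qed.

Let conjv v : 'cV[C]_#|X| := map_mx Num.conj v.

Let conjW i j v : v \in W i j -> conjv v \in W i j.
Proof.
rewrite !memv_cap => /andP[/PXP Xv /PYP Yv]; apply/andP; split.
  by apply/PXP; rewrite -[in RHS]Xv /conjv map_mxM (proj2 (PXrs i)).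
by apply/PYP; rewrite -[in RHS]Yv /conjv map_mxM (proj2 (PYrs j)).
Qed.

Let conjvK v : conjv (conjv v) = v.
Proof. by apply/matrixP => k l; rewrite !mxE conjCK. Qed.

Let herm_conjv u v : herm (conjv u) v = (herm u (conjv v))^*.
Proof.
rewrite !hermE rmorph_sum; apply: eq_bigr => k _.
by rewrite !mxE rmorphM /= conjCK.
Qed.

Let split_conjv i j v : split_part i j v -> split_part i j (conjv v).
Proof.
have orth_conj r s : orth (W r s) v -> orth (W r s) (conjv v).
  by move=> ov w Ww; rewrite herm_conjv ov ?conjC0 // conjW.
by case=> Wv o1 o2; split; [exact: conjW|exact: orth_conj..].
Qed.

Variable N : nat.
Hypothesis XSN : XS N = fullv.
Hypothesis YSN : YS N = fullv.

(** The split parts span: by induction on [i + j], a vector of [W i j] is a sum of vectors from the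
    two smaller subspaces and a vector orthogonal to them. *)
Let split_ind (P : 'cV[C]_#|X| -> Prop) :
  P 0 -> (forall u v, P u -> P v -> P (u + v)) ->
  (forall i j v, (i < N)%N -> (j < N)%N -> split_part i.+1 j.+1 v -> P v) ->
  forall v, P v.
Proof.
move=> P0 PD PW v.
suff PWn n i j u : (i + j <= n)%N -> (i <= N)%N -> (j <= N)%N ->
    u \in W i j -> P u.
  by apply: (PWn (N + N)%N N N); rewrite // memv_cap XSN YSN !memvf.
elim: n => [|n IH] in i j u *; case: i => [|i]; try by move=> _ _ _ /W0l->.
  by [].
case: j => [|j]; first by move=> _ _ _ /W0r->.
move=> leijn lti ltj Wu.
have [s [t [Du Ss ot]]] := orth_decomp (W i j.+1 + W i.+1 j)%VS u.
have Wt : t \in W i.+1 j.+1.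
  have -> : t = u - s by rewrite Du addrC addKr.
  by rewrite memvB // (subvP _ _ Ss) // subv_add !leW.
rewrite Du; apply: (PD).
  case/memv_addP: Ss => w1 W1 [w2 W2 ->]; apply: (PD).
    by apply: IH W1; rewrite // ?(ltnW lti) // -ltnS -addSn.
  by apply: IH W2; rewrite // ?(ltnW ltj) // -ltnS -addnS.
apply: PW lti ltj _; split=> //=; apply: orthS ot; rewrite ?addvSl ?addvSr //.
Qed.

(** It suffices to compare the bilinear forms of [M] and [M^T] on split parts. Equal index sums give
    equal eigenvalues. Otherwise [v^T *m u] is zero, being the Hermitian product of [v] with the
    conjugate of [u], which is again a split part. *)
Theorem split_eigen_symmetric (M : 'M[C]_#|X|) (lam : nat -> C) :
  (forall i j v, (i < N)%N -> (j < N)%N -> v \in (XS i.+1 :&: YS j.+1)%VS ->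
     orth (XS i :&: YS j.+1 + XS i.+1 :&: YS j)%VS v ->
     M *m v = lam (i + j)%N *: v) ->
  M^T = M.
Proof.
move=> MW.
have eigen i j v : (i < N)%N -> (j < N)%N -> split_part i.+1 j.+1 v ->
    M *m v = lam (i + j)%N *: v.
  by move=> lti ltj [Wv o1 o2]; apply: MW => //; apply: orth_addv.
suff sym v u : v^T *m (M^T *m u) = v^T *m (M *m u).
  apply/matrixP => k l; have := sym (delta_mx k 0) (delta_mx l 0).
  by rewrite trmx_delta -!rowE -!colE => /matrixP/(_ 0 0); rewrite !mxE.
elim/split_ind: v => [|v v' IHv IHv'|i j v lti ltj Pv].
- by rewrite trmx0 !mul0mx.
- by rewrite linearD !mulmxDl IHv IHv'.
elim/split_ind: u => [|u u' IHu IHu'|r s u ltr lts Pu].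
- by rewrite !mulmx0.
- by rewrite !mulmxDr IHu IHu'.
rewrite mulmxA -trmx_mul (eigen _ _ _ lti ltj Pv) (eigen _ _ _ ltr lts Pu).
rewrite linearZ -scalemxAl -scalemxAr.
have [->//|ne] := eqVneq (i + j)%N (r + s)%N.
suff -> : v^T *m u = 0 by rewrite !scaler0.
apply/matrixP => k l; rewrite !ord1 [RHS]mxE.
rewrite -[u]conjvK; apply: (split_orth Pv (split_conjv Pu)).
by rewrite !addSn !addnS !eqSS.
Qed.

End SplitDecomposition.

(** * Orthogonal resolutions of the identity and their flags *)

Section Resolution.
Variables (X : finType) (C : numClosedFieldType) (n : nat).
Implicit Types (F : 'I_n -> 'M[C]_#|X|) (v : 'cV[C]_#|X|).

Definition resolution F : Prop :=
  [/\ forall i, real_symmetric (F i),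
      forall i j, F i *m F j = if i == j then F i else 0 &
      \sum_i F i = 1%:M].

Lemma resolution_rev F : resolution F -> resolution (F \o @rev_ord n).
Proof.
case=> rs orF sumF; split=> [i|i j|]; first exact: rs.
  by rewrite /= orF (inj_eq rev_ord_inj).
by rewrite -sumF [RHS](reindex_inj rev_ord_inj).
Qed.

(** The strict bound makes [flag F 0] zero and [flag F i.+1] the sum of the images of index at most
    [i], which is the shift used for [XS] and [YS]. *)
Definition flag F (m : nat) : {vspace 'cV[C]_#|X|} :=
  (\sum_(h < n | (h < m)%N) mximage (F h))%VS.

Definition flag_proj F (m : nat) : 'M[C]_#|X| := \sum_(h < n | (h < m)%N) F h.

Variable F : 'I_n -> 'M[C]_#|X|.
Hypothesis resF : resolution F.

Lemma resolution_split v : v = \sum_h F h *m v.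
Proof. by rewrite -mulmx_suml (let: And3 _ _ s := resF in s) mul1mx. Qed.

Lemma flag_projM m j : flag_proj F m *m F j = if (j < m)%N then F j else 0.
Proof.
have [_ orF _] := resF; rewrite mulmx_suml.
have [ltj|lej] := ltnP j m; last first.
  apply: big1 => h lth; rewrite orF; case: eqP => // Dh.
  by move: lth; rewrite Dh ltnNge lej.
rewrite (bigD1 j) //= orF eqxx big1 ?addr0 // => h /andP[_ ne].
by rewrite orF (negbTE ne).
Qed.

Lemma memv_mximage (M : 'M[C]_#|X|) v : M *m v \in mximage M.
Proof. by rewrite -(lfunE (mulmx M : 'cV[C]_#|X| -> _)) memv_img ?memvf. Qed.

Lemma mximageP (M : 'M[C]_#|X|) v : v \in mximage M -> exists u, v = M *m u.
Proof. by case/memv_imgP => u _ ->; exists u; rewrite lfunE. Qed.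

Lemma flagP m v : v \in flag F m <-> flag_proj F m *m v = v.
Proof.
split=> [|<-].
  case/memv_sumP=> f Wf ->; rewrite mulmx_sumr; apply: eq_bigr => h lth.
  by have [u ->] := mximageP (Wf h lth); rewrite mulmxA flag_projM lth.
rewrite mulmx_suml; apply: memv_sumr => h _; exact: memv_mximage.
Qed.

Lemma memv_flag m (h : 'I_n) v : (h < m)%N -> F h *m v \in flag F m.
Proof.
move=> lth; have := memv_mximage (F h) v.
by apply: subvP; apply: (sumv_sup h).
Qed.

Lemma flag0 : flag F 0 = 0%VS.
Proof. exact: big_pred0_eq. Qed.

Lemma flagS m : (flag F m <= flag F m.+1)%VS.
Proof. by apply/subv_sumP => h /ltnW lth; apply: (sumv_sup h). Qed.

Lemma flag_full : flag F n = fullv.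
Proof.
apply/eqP; rewrite eqEsubv subvf; apply/subvP => v _.
rewrite (resolution_split v).
by apply: memv_suml => h _; apply: memv_flag.
Qed.

Lemma flag_proj_real_symmetric m : real_symmetric (flag_proj F m).
Proof.
have [rs _ _] := resF; split; rewrite /flag_proj.
  by rewrite linear_sum; apply: eq_bigr => h _; case: (rs h).
by rewrite raddf_sum; apply: eq_bigr => h _; case: (rs h).
Qed.

Lemma flag_split m v : v \in flag F m -> v = \sum_(h < n | (h < m)%N) F h *m v.
Proof. by move=> /flagP {1}<-; rewrite mulmx_suml. Qed.

Lemma flag_raise (M : 'M[C]_#|X|) m v :
  (forall h j : 'I_n, (j.+1 < h)%N -> F h *m M *m F j = 0) ->
  v \in flag F m -> M *m v \in flag F m.+1.
Proof.
move=> FMF vm; rewrite (resolution_split (M *m v)); apply: memv_suml => h _.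
have [lth|leh] := ltnP h m.+1; first exact: memv_flag.
rewrite (flag_split vm) !mulmx_sumr big1 ?mem0v // => j ltj.
by rewrite !mulmxA FMF ?mul0mx // (leq_ltn_trans ltj).
Qed.

Lemma flag_lower (M : 'M[C]_#|X|) (th : 'I_n -> C) m :
  (forall j, M *m F j = th j *: F j) ->
  exists a, forall v, v \in flag F m.+1 -> M *m v - a *: v \in flag F m.
Proof.
(* The scalar is the eigenvalue on the top component. For [m >= n] there is no such component and
   any scalar works, here 0. *)
move=> MF; exists (if insub m is Some j then th j else 0) => v vm.
rewrite (flag_split vm) mulmx_sumr scaler_sumr -sumrB; apply: memv_suml => h.
rewrite ltnS mulmxA MF -scalemxAl leq_eqVlt => /predU1P[<-|lth].
  by rewrite valK subrr mem0v.
by rewrite memvB // memvZ // memv_flag.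
Qed.

Lemma flag_stable (S : {vspace 'cV[C]_#|X|}) m :
  (forall h, stable (F h) S) -> stable (flag_proj F m) S.
Proof.
move=> FS v Sv; rewrite mulmx_suml; apply: memv_suml => h _; exact: FS.
Qed.

End Resolution.

(** * The Bose-Mesner algebra: commutative, symmetric, with real idempotents *)

Section BoseMesnerAlgebra.
Variables (X : finType) (e : rel X) (C : numClosedFieldType) (x : X).
Hypothesis e_sym : symmetric e.
Hypothesis e_conn : connected_graph e.
Hypothesis e_dr : distance_regular e.

Local Notation D := (diameter e).
Local Notation BM := (bose_mesner e C).
Local Notation p := (intersection_number e).
Implicit Types (M N : 'M[C]_#|X|) (S : {vspace 'cV[C]_#|X|}).

Lemma dist_mx0 : dist_mx e C 0 = 1%:M.
Proof.
by apply/matrixP => k l; rewrite !mxE dist_eq0 // (inj_eq enum_val_inj).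
Qed.

Lemma dist_mx_real_symmetric i : real_symmetric (dist_mx e C i).
Proof.
split; apply/matrixP => k l; rewrite !mxE; last by rewrite conjC_nat.
by rewrite dist_sym.
Qed.

Lemma big_dist (V : nmodType) (F : nat -> V) (y z : X) :
  \sum_(h < D.+1) (F h *+ (dist e y z == h)) = F (dist e y z).
Proof.
have lt : (dist e y z < D.+1)%N by rewrite ltnS dist_le_diameter.
rewrite (bigD1 (Ordinal lt)) //= eqxx mulr1n big1 ?addr0 // => h ne.
by rewrite eq_sym; move: ne; rewrite -val_eqE /= => /negbTE->; rewrite mulr0n.
Qed.

Lemma sum_enum_val (V : nmodType) (F : X -> V) :
  \sum_(k < #|X|) F (enum_val k) = \sum_z F z.
Proof. by rewrite [RHS](reindex _ (onW_bij _ (enum_val_bij X))). Qed.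

Lemma dist_mxM i j :
  dist_mx e C i *m dist_mx e C j =
    \sum_(h < D.+1) (p h i j)%:R *: dist_mx e C h.
Proof.
apply/matrixP => k l; set y := enum_val k; set z := enum_val l.
transitivity ((p (dist e y z) i j)%:R : C); last first.
  rewrite -(big_dist (fun h => (p h i j)%:R)) summxE.
  by apply: eq_bigr => h _; rewrite !mxE mulr_natr.
rewrite intersection_numberE // /nb_between -sum1_card natr_sum big_mkcond /=.
rewrite -sum_enum_val mxE; apply: eq_bigr => m _.
by rewrite inE !mxE -natrM mulnb; case: (_ && _).
Qed.

Lemma bose_mesnerP M :
  reflect (exists c : 'I_D.+1 -> C, M = \sum_i c i *: dist_mx e C i) (M \in BM).
Proof.
apply: (iffP memv_sumP) => [[f Wf ->]|[c ->]].
  have /fin_all_exists[c Dc] : forall i, exists a, f i = a *: dist_mx e C i.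
    by move=> i; have /vlineP[a ->] := Wf i isT; exists a.
  by exists c; apply: eq_bigr => i _.
by exists (fun i => c i *: dist_mx e C i) => // i _; rewrite memvZ ?memv_line.
Qed.

Lemma memv_dist_mx (i : 'I_D.+1) : dist_mx e C i \in BM.
Proof. by rewrite (subvP (sumv_sup i isT (subvv _))) ?memv_line. Qed.

Lemma bose_mesnerM M N : M \in BM -> N \in BM -> M *m N \in BM.
Proof.
case/bose_mesnerP=> c ->; case/bose_mesnerP=> d ->.
rewrite mulmx_suml; apply: memv_suml => i _.
rewrite mulmx_sumr; apply: memv_suml => j _.
rewrite -scalemxAl -scalemxAr !memvZ // dist_mxM.
by apply: memv_suml => h _; rewrite memvZ // memv_dist_mx.
Qed.

Lemma bose_mesner_tr M : M \in BM -> M^T = M.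
Proof.
case/bose_mesnerP=> c ->; rewrite linear_sum; apply: eq_bigr => i _.
by rewrite linearZ /= (proj1 (dist_mx_real_symmetric i)).
Qed.

Lemma bose_mesner_conj M : M \in BM -> map_mx Num.conj M \in BM.
Proof.
case/bose_mesnerP=> c ->; rewrite raddf_sum; apply: memv_suml => i _ /=.
by rewrite map_mxZ (proj2 (dist_mx_real_symmetric i)) memvZ // memv_dist_mx.
Qed.

(** Every element of the algebra, including the product, is symmetric, and transposition reverses
    products. *)
Lemma bose_mesnerC M N : M \in BM -> N \in BM -> M *m N = N *m M.
Proof.
move=> BMM BMN; rewrite -[LHS](bose_mesner_tr (bose_mesnerM BMM BMN)).
by rewrite trmx_mul !bose_mesner_tr.
Qed.

(** This trace is the sum of the squared moduli of the entries. *)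
Lemma mxtrace_mul_conj_eq0 M : \tr (M *m (map_mx Num.conj M)^T) = 0 -> M = 0.
Proof.
have E i : (M *m (map_mx Num.conj M)^T) i i = \sum_j M i j * (M i j)^*.
  by rewrite mxE; apply: eq_bigr => j _; rewrite !mxE.
rewrite /mxtrace (eq_bigr _ (fun i _ => E i)) => /psumr_eq0P tr0.
apply/matrixP => k l; rewrite [RHS]mxE; apply/eqP; rewrite -mul_conjC_eq0.
apply/eqP; move: l isT; apply: psumr_eq0P => [j _|].
  exact: mul_conjC_ge0.
by apply: tr0 => // i _; apply: sumr_ge0 => j _; apply: mul_conjC_ge0.
Qed.

(* [M] commutes with its adjoint [N], so [M - N M] has norm zero and
   [M = N M] is Hermitian. *)
Lemma bose_mesner_idem_real M : M \in BM -> M *m M = M -> real_symmetric M.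
Proof.
move=> BMM MM; pose N := map_mx Num.conj M.
have BMN : N \in BM by apply: bose_mesner_conj.
have NN : N *m N = N by rewrite -map_mxM MM.
have MN := bose_mesnerC BMM BMN.
have Nc : map_mx Num.conj N = M by apply/matrixP => k l; rewrite !mxE conjCK.
have DM : M = N *m M.
  apply/eqP; rewrite -subr_eq0; apply/eqP; apply: mxtrace_mul_conj_eq0.
  rewrite map_mxB map_mxM Nc -/N MN linearB /= trmx_mul !bose_mesner_tr // MN.
  have QM : M *m (N *m M) = N *m M by rewrite mulmxA MN -mulmxA MM.
  have QN : N *m M *m N = N *m M by rewrite -mulmxA MN mulmxA NN.
  have QQ : N *m M *m (N *m M) = N *m M by rewrite mulmxA QN -mulmxA MM.
  by rewrite mulmxBl !mulmxBr MN QM QN QQ !subrr mxtrace0.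
split; first exact: bose_mesner_tr.
by have := congr1 (map_mx Num.conj) DM; rewrite map_mxM Nc -/N MN -DM.
Qed.

End BoseMesnerAlgebra.

(** * Families generated by one member through a three-term recurrence *)

Section Generation.
Variables (X : finType) (e : rel X) (C : numClosedFieldType) (x : X).
Hypothesis e_sym : symmetric e.
Hypothesis e_conn : connected_graph e.
Hypothesis e_dr : distance_regular e.

Local Notation D := (diameter e).
Local Notation p := (intersection_number e).
Implicit Types (M : 'I_D.+1 -> 'M[C]_#|X|) (S : {vspace 'cV[C]_#|X|}).

(* The three-term recurrence p^h_{1j} makes [M h] a polynomial in [M o]. *)
Lemma stable_generated M (o : 'I_D.+1) S : o = 1%N :> nat ->
  M ord0 = 1%:M ->
  (forall j, M o *m M j = \sum_(h < D.+1) (p h o j)%:R *: M h) ->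
  stable (M o) S -> forall h, stable (M h) S.
Proof.
move=> o1 M0 rec MoS [h lth]; elim/ltn_ind: h lth => -[|h] IH lth v Sv.
  by rewrite (_ : Ordinal lth = ord0) ?M0 ?mul1mx //; apply: val_inj.
(* This is c_{h+1}, the coefficient of [M h.+1] in the product of [M o] and [M h]; being nonzero, it
   lets the recurrence be solved for [M h.+1]. *)
have p_neq0 : ((p h.+1 o h)%:R : C) != 0.
  by rewrite pnatr_eq0 o1 -[h.+1]add1n intersection_number_neq0.
pose j : 'I_D.+1 := Ordinal (ltnW lth).
have : M o *m (M j *m v) \in S by apply: MoS; apply: IH.
rewrite mulmxA rec (bigD1 (Ordinal lth)) //= mulmxDl -scalemxAl => Su.
rewrite -[_ *m v](scalerK p_neq0) memvZ //.
pose T := \sum_(h' < D.+1 | h' != Ordinal lth) (p h' o h)%:R *: M h'.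
rewrite -[_ *: (_ *m v)](addrK (T *m v)).
rewrite memvB //= mulmx_suml; apply: memv_suml => h' ne.
(* Terms below [h.+1] are covered by induction; those above have zero coefficient by the triangle
   inequality. *)
rewrite -scalemxAl; have [ltn|] := ltnP h' h.+1.
  rewrite memvZ // (_ : h' = Ordinal (ltn_ord h')); first exact: IH.
  exact: val_inj.
rewrite leq_eqVlt => /predU1P[Dh|lt_h].
  by case/eqP: ne; apply: val_inj.
by rewrite intersection_number0 ?scale0r ?mem0v // o1 add1n leqNgt lt_h.
Qed.

End Generation.

(** * The primitive idempotents as an orthogonal basis of the Bose-Mesner algebra *)

Section PrimitiveIdempotents.
Variables (X : finType) (e : rel X) (C : numClosedFieldType) (x : X).
Hypothesis e_sym : symmetric e.
Hypothesis e_conn : connected_graph e.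
Hypothesis e_dr : distance_regular e.

Local Notation D := (diameter e).
Local Notation BM := (bose_mesner e C).
Implicit Types (M N : 'M[C]_#|X|) (S : {vspace 'cV[C]_#|X|}).

Variable E : 'I_D.+1 -> 'M[C]_#|X|.
Hypothesis E_prim : primitive_idempotent_ordering E.

Lemma prim_memv i : E i \in BM.
Proof. by have [_ /(_ i)[]] := E_prim. Qed.

(** The product of two commuting idempotents is an idempotent below both. By minimality it is zero
    or equal to both factors, and the latter contradicts injectivity of [E]. *)
Lemma prim_mulmx i j : E i *m E j = if i == j then E i else 0.
Proof.
have [injE prim _] := E_prim.
have [BMi ii i0 mini] := prim i; have [BMj jj j0 minj] := prim j.
have EC := bose_mesnerC e_sym e_conn e_dr BMi BMj.
case: eqP => [<-//|ne]; set F := E i *m E j.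
have BMF : F \in BM by apply: bose_mesnerM.
have iF : E i *m F = F by rewrite mulmxA ii.
have Fj : F *m E j = F by rewrite -mulmxA jj.
have Fi : F *m E i = F by rewrite /F EC -mulmxA ii.
have jF : E j *m F = F by rewrite /F EC mulmxA jj.
have FF : F *m F = F by rewrite {1}/F -mulmxA jF.
have [//|Di] := mini F BMF FF iF Fi.
have [//|Dj] := minj F BMF FF jF Fj.
by case: ne; apply: injE; rewrite -Di.
Qed.

Lemma prim_lin_indep (c : 'I_D.+1 -> C) i :
  (\sum_j c j *: E j) *m E i = c i *: E i.
Proof.
rewrite mulmx_suml (bigD1 i) //= -scalemxAl prim_mulmx eqxx big1 ?addr0 //.
by move=> j /negbTE ne; rewrite -scalemxAl prim_mulmx ne scaler0.
Qed.

Lemma prim_neq0 i : E i != 0.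
Proof. by have [_ /(_ i)[]] := E_prim. Qed.

(** Dimension count: the [D.+1] independent idempotents lie in a space spanned by [D.+1] distance
    matrices. *)
Lemma prim_span M : M \in BM -> exists c : 'I_D.+1 -> C, M = \sum_i c i *: E i.
Proof.
pose V := (\sum_i <[E i]>)%VS.
have sVB : (V <= BM)%VS.
  by apply/subv_sumP => i _; rewrite -memvE prim_memv.
have dimB : (\dim BM <= D.+1)%N.
  rewrite /bose_mesner; apply: leq_trans (dimv_leq_sum _ _ _) _.
  rewrite -[leqRHS]card_ord -[leqRHS]sum1_card; apply: leq_sum => i _.
  by rewrite dim_vline leq_b1.
have dimV : \dim V = D.+1.
  have /directvP dV : directv (\sum_i <[E i]>)%VS.
    apply/directv_sum_independent => u Wu Du i _.
    have /fin_all_exists[c Dc] j : exists a, u j = a *: E j.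
      by have /vlineP[a ->] := Wu j isT; exists a.
    have := prim_lin_indep c i; rewrite -(eq_bigr _ (fun j _ => Dc j)) Du.
    by rewrite mul0mx -Dc.
  rewrite [LHS]dV /= (eq_bigr (fun=> 1%N)) ?sum1_card ?card_ord //.
  by move=> i _; rewrite dim_vline prim_neq0.
have : V = BM.
  by apply/eqP; rewrite eqEdim sVB dimV.
move=> <- /memv_sumP[f Wf ->].
have /fin_all_exists[c Dc] j : exists a, f j = a *: E j.
  by have /vlineP[a ->] := Wf j isT; exists a.
by exists c; apply: eq_bigr.
Qed.

Lemma prim_sum : \sum_i E i = 1%:M.
Proof.
have : 1%:M \in BM.
  by rewrite -(dist_mx0 C e_conn) (memv_dist_mx C (ord0 : 'I_D.+1)).
case/prim_span=> c D1; rewrite [RHS]D1; apply: eq_bigr => i _.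
by rewrite -(prim_lin_indep c) -D1 mul1mx.
Qed.

Lemma prim_resolution : resolution E.
Proof.
split; [|exact: prim_mulmx|exact: prim_sum] => i; have [_ prim _] := E_prim.
have [BMi ii _ _] := prim i; exact: bose_mesner_idem_real.
Qed.

Lemma prim_eigen M : M \in BM ->
  exists th : 'I_D.+1 -> C, forall j, M *m E j = th j *: E j.
Proof. by case/prim_span=> c ->; exists c => j; apply: prim_lin_indep. Qed.

End PrimitiveIdempotents.

(** * Dual idempotents and dual distance matrices *)

Section DualAdjacency.
Variables (X : finType) (e : rel X) (C : numClosedFieldType) (x : X).
Hypothesis e_sym : symmetric e.
Hypothesis e_conn : connected_graph e.
Hypothesis e_dr : distance_regular e.

Local Notation D := (diameter e).
Local Notation p := (intersection_number e).
Implicit Types (M N : 'M[C]_#|X|) (S : {vspace 'cV[C]_#|X|}).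

Lemma EstarE i :
  Estar e C x i = diag_mx (\row_k (dist e x (enum_val k) == i)%:R).
Proof. by apply/matrixP => k l; rewrite !mxE; case: eqP; case: eqP. Qed.

Lemma Estar_resolution : resolution (fun i : 'I_D.+1 => Estar e C x i).
Proof.
split=> [i|i j|].
- split; apply/matrixP => k l; rewrite !mxE ?conjC_nat //.
  by case: eqVneq => [->|ne]; rewrite ?eqxx // eq_sym (negbTE ne).
- rewrite !EstarE mulmx_diag; apply/matrixP => k l; rewrite !mxE -natrM mulnb.
  case: ifP => [/eqP->|ne]; first by rewrite andbb !mxE.
  rewrite mxE; case: (_ =P val i) => [->|]; last by rewrite mul0rn.
  by rewrite (inj_eq val_inj) ne mul0rn.
apply/matrixP => k l; rewrite summxE !mxE.
rewrite -(big_dist e (fun=> (k == l)%:R) x (enum_val k)); apply: eq_bigr => i _.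
by rewrite mxE; case: eqP; case: eqP.
Qed.

Lemma Estar_raise (h j : nat) : (j.+1 < h)%N ->
  Estar e C x h *m dist_mx e C 1 *m Estar e C x j = 0.
Proof.
move=> lt; rewrite !EstarE mul_diag_mx mul_mx_diag; apply/matrixP => k l.
rewrite !mxE -!natrM !mulnb.
case: eqP => //= Dh; case: eqP => //= D1; case: eqP => //= Dj.
have := dist_triangle e_conn x (enum_val l) (enum_val k).
by rewrite Dh Dj (dist_sym e_conn e_sym) D1 addn1 leqNgt lt.
Qed.

Variable E : 'I_D.+1 -> 'M[C]_#|X|.
Variable kr : 'I_D.+1 -> 'I_D.+1 -> 'I_D.+1 -> C.
Hypothesis E_prim : primitive_idempotent_ordering E.
Hypothesis E_kr : krein_parameters E kr.
Hypothesis krE : forall h i j, kr h i j = (p h i j)%:R.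

Let n_neq0 : #|X|%:R != 0 :> C.
Proof. by rewrite pnatr_eq0 -lt0n; apply/card_gt0P; exists x. Qed.

Lemma prim_hadamard i j k l :
  E i k l * E j k l = #|X|%:R^-1 * \sum_(h < D.+1) (p h i j)%:R * E h k l.
Proof.
have /matrixP/(_ k l) := E_kr i j; rewrite !mxE summxE => ->.
by congr (_ * _); apply: eq_bigr => h _; rewrite mxE krE.
Qed.

(** Since p^h_{0j} is 1 for h = j and 0 otherwise, entrywise multiplication by [E ord0] scales each
    [E j], hence the whole algebra, by [#|X|%:R^-1]. It remains to apply this to the distance matrix
    whose [(k, l)] entry is 1. *)
Lemma prim0E k l : E ord0 k l = #|X|%:R^-1.
Proof.
pose d := dist e (enum_val k) (enum_val l).
have ltd : (d < D.+1)%N by rewrite ltnS dist_le_diameter.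
have [c Dc] :=
  prim_span e_sym e_conn e_dr E_prim (memv_dist_mx C (Ordinal ltd)).
have := congr1 (fun M : 'M_ _ => M k l) Dc.
rewrite mxE eqxx mulr1n summxE => D1.
have mulc (a : C) : a = \sum_j a * (c j *: E j) k l.
  by rewrite -mulr_sumr -D1 mulr1.
rewrite [LHS]mulc [RHS]mulc.
apply: eq_bigr => j _; rewrite mxE mulrCA prim_hadamard mulrCA.
rewrite (bigD1 j) //= intersection_number_0l // -1?ltnS // eqxx mul1r.
rewrite big1 ?addr0 // => h ne; rewrite intersection_number_0l // -1?ltnS //.
by rewrite (inj_eq val_inj) (negbTE ne) mul0r.
Qed.

(* The paper's dual distance matrix A^*_j with respect to [x]. *)
Definition dual_mx (j : 'I_D.+1) : 'M[C]_#|X| :=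
  diag_mx (#|X|%:R *: row (enum_rank x) (E j)).

Lemma dual_mx0 : dual_mx ord0 = 1%:M.
Proof. by apply/matrixP => k l; rewrite !mxE prim0E divff. Qed.

(** The Krein identity read along the row of [x]. The structure constants are those of the distance
    matrices, so [stable_generated] serves both families. *)
Lemma dual_mxM i j :
  dual_mx i *m dual_mx j = \sum_(h < D.+1) (p h i j)%:R *: dual_mx h.
Proof.
rewrite mulmx_diag; apply/matrixP => k l; rewrite summxE !mxE.
rewrite mulrACA prim_hadamard mulrA mulfK // mulr_sumr -sumrMnl.
by apply: eq_bigr => h _; rewrite !mxE mulrnAr mulrCA.
Qed.

(** [E j] is a combination of distance matrices, so its entries in the row of [x] depend only on the
    distance from [x]. *)
Lemma dual_mx_eigen j :
  exists th : 'I_D.+1 -> C,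
    forall i : 'I_D.+1, dual_mx j *m Estar e C x i = th i *: Estar e C x i.
Proof.
have /bose_mesnerP[c Dc] := prim_memv E_prim j.
exists (fun i => #|X|%:R * c i) => i.
have Ej k : E j (enum_rank x) k * (dist e x (enum_val k) == i)%:R
            = c i * (dist e x (enum_val k) == i)%:R.
  case: (_ =P val i) => [Di|]; last by rewrite !mulr0.
  rewrite !mulr1 Dc summxE (bigD1 i) //= !mxE enum_rankK Di eqxx mulr1.
  rewrite big1 ?addr0 // => h ne; rewrite !mxE enum_rankK Di.
  by rewrite eq_sym (inj_eq val_inj) (negbTE ne) mulr0.
rewrite EstarE mulmx_diag; apply/matrixP => k l.
by rewrite !mxE -mulrA Ej mulrA [RHS]mulrnAr.
Qed.

(** The diagonal of [Estar e C x i] is the row of [x] in the distance matrix of index [i]. Expanding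
    that matrix in the [E j] gives a combination of the [dual_mx j], and these are generated by
    [dual_mx o]. *)
Lemma dual_mx_stable S (o : 'I_D.+1) : o = 1%N :> nat ->
  stable (dual_mx o) S -> forall i : 'I_D.+1, stable (Estar e C x i) S.
Proof.
move=> o1 oS i v Sv.
have dS := stable_generated x e_sym e_conn e_dr o1 dual_mx0 (dual_mxM o) oS.
have [c Dc] := prim_span e_sym e_conn e_dr E_prim (memv_dist_mx C i).
have -> : Estar e C x i = \sum_j (c j / #|X|%:R) *: dual_mx j.
  apply/matrixP => k l; rewrite EstarE summxE.
  transitivity ((dist_mx e C i (enum_rank x) k) *+ (k == l)).
    by rewrite !mxE enum_rankK.
  rewrite Dc summxE -sumrMnl; apply: eq_bigr => j _.
  by rewrite !mxE mulrnAr mulrA divfK.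
by rewrite mulmx_suml; apply: memv_suml => j _; rewrite -scalemxAl memvZ // dS.
Qed.

(** The squared norm of the triple product equals [#|X|%:R] times the sum over [m] of p^m_{hj} times
    the [(x, x)] entry of [E o *m E m *m E o]. Only [m = o] can contribute, and its coefficient is
    zero. *)
Lemma dual_mx_triple (o h j : 'I_D.+1) : p o h j = 0%N ->
  E h *m dual_mx o *m E j = 0.
Proof.
move=> p0; have [rs orE _] := prim_resolution e_sym e_conn e_dr E_prim.
apply: mxtrace_mul_conj_eq0; set d := dual_mx o.
have dT : d^T = d by rewrite /d /dual_mx tr_diag_mx.
have dc : map_mx Num.conj d = d.
  rewrite /d /dual_mx map_diag_mx; congr diag_mx; apply/rowP => k.
  rewrite !mxE rmorphM /= conjC_nat; congr (_ * _).
  by rewrite -[in RHS](proj2 (rs o)) mxE.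
rewrite !map_mxM dc (proj2 (rs h)) (proj2 (rs j)) !trmx_mul dT.
rewrite (proj1 (rs h)) (proj1 (rs j)).
rewrite -!mulmxA (mulmxA (E j) (E j)) orE eqxx mxtrace_mulC -!mulmxA orE eqxx.
rewrite !mulmxA /dual_mx mul_diag_mx mul_mx_diag /mxtrace.
pose y := enum_rank x.
have Esym i k l : E i k l = E i l k by rewrite -{1}(proj1 (rs i)) mxE.
transitivity (#|X|%:R * \sum_(m < D.+1) (p m h j)%:R * (E o *m E m *m E o) y y).
  transitivity (#|X|%:R * \sum_(m < D.+1) \sum_k \sum_l
      (p m h j)%:R * (E o y k * E m k l * E o l y)).
    rewrite exchange_big mulr_sumr; apply: eq_bigr => k _ /=.
    rewrite mxE exchange_big mulr_sumr; apply: eq_bigr => l _ /=.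
    rewrite !mxE -/y (Esym h l k) (Esym o l y).
    rewrite (eq_bigr (fun m : 'I_D.+1 =>
        E o y k * E o y l * ((p m h j)%:R * E m k l))); last first.
      by move=> m _; ring.
    rewrite -mulr_sumr -[X in _ = _ * (_ * X)](mulVKf n_neq0) -prim_hadamard.
    ring.
  congr (_ * _); apply: eq_bigr => m _; rewrite mxE mulr_sumr exchange_big.
  apply: eq_bigr => l _ /=; rewrite mxE mulr_suml mulr_sumr.
  by apply: eq_bigr => k _.
rewrite big1 ?mulr0 // => m _; rewrite orE; case: eqP => [<-|_].
  by rewrite p0 mul0r.
by rewrite mul0mx mxE mulr0.
Qed.

End DualAdjacency.

(** * Translation from integer-indexed split subspaces to flags *)

Section SplitFlags.
Variables (X : finType) (e : rel X) (C : numClosedFieldType) (x : X).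
Local Notation D := (diameter e).
Variable E : 'I_D.+1 -> 'M[C]_#|X|.

Lemma orth_acts (V : int -> int -> {vspace 'cV[C]_#|X|}) (q : C) M
    (XS YS : nat -> {vspace 'cV[C]_#|X|}) :
  (forall i j : nat, V (i%:Z - 1) (j%:Z - 1) = (XS i :&: YS j)%VS) ->
  acts_on_split e V q M ->
  forall (i j : 'I_D.+1) v, v \in (XS i.+1 :&: YS j.+1)%VS ->
    orth (XS i :&: YS j.+1 + XS i.+1 :&: YS j)%VS v ->
    M *m v = q ^ ((i + j)%N%:Z - D%:Z) *: v.
Proof.
move=> VE MV i j v; have predZ (n : nat) : n%:Z = n.+1%:Z - 1 by lia.
rewrite PoszD -!VE -!predZ => Wv ov; exact: MV.
Qed.

Lemma Vdd_flag (i j : nat) : Vdd x E (i%:Z - 1) (j%:Z - 1) =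
  (flag (fun h : 'I_D.+1 => Estar e C x h) i :&: flag E j)%VS.
Proof. by congr (_ :&: _)%VS; apply: eq_bigl => h; lia. Qed.

(** Reversing the order of the idempotents turns the sums that descend from index [D] into initial
    flags. *)
Lemma Vdu_flag (i j : nat) : Vdu x E (i%:Z - 1) (j%:Z - 1) =
  (flag (fun h : 'I_D.+1 => Estar e C x h) i :&:
   flag (E \o @rev_ord D.+1) j)%VS.
Proof.
congr (_ :&: _)%VS; first by apply: eq_bigl => h; lia.
rewrite (reindex_inj rev_ord_inj); apply: eq_bigl => h /=.
by have := ltn_ord h; lia.
Qed.

End SplitFlags.

(** * Symmetry of operators acting by scalars on a split decomposition *)

Section SplitOperator.
Variables (X : finType) (e : rel X) (C : numClosedFieldType) (x : X).
Hypothesis e_sym : symmetric e.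
Hypothesis e_conn : connected_graph e.
Hypothesis e_dr : distance_regular e.
Hypothesis D_gt0 : (0 < diameter e)%N.

Local Notation D := (diameter e).
Local Notation p := (intersection_number e).

Variable E : 'I_D.+1 -> 'M[C]_#|X|.
Variable kr : 'I_D.+1 -> 'I_D.+1 -> 'I_D.+1 -> C.
Hypothesis E_prim : primitive_idempotent_ordering E.
Hypothesis E_kr : krein_parameters E kr.
Hypothesis krE : forall h i j, kr h i j = (p h i j)%:R.

Let o : 'I_D.+1 := Ordinal (D_gt0 : (1 < D.+1)%N).

Lemma prim_stable S : stable (dist_mx e C 1) S -> forall i, stable (E i) S.
Proof.
move=> AS i v Sv.
have dS := stable_generated (M := fun h => dist_mx e C h) (o := o)
  x e_sym e_conn e_dr erefl (dist_mx0 C e_conn)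
  (fun j => dist_mxM C e_dr 1 j) AS.
have /bose_mesnerP[c ->] := prim_memv E_prim i.
by rewrite mulmx_suml; apply: memv_suml => j _; rewrite -scalemxAl memvZ // dS.
Qed.

(** The reordering [s] treats both decompositions at once. The vanishing condition says that the
    dual adjacency matrix raises the flag of [E \o s] by at most one step. *)
Lemma split_operator_symmetric (s : 'I_D.+1 -> 'I_D.+1) (lam : nat -> C)
    (M : 'M[C]_#|X|) :
  resolution (E \o s) ->
  (forall h j : 'I_D.+1, (j.+1 < h)%N -> p o (s h) (s j) = 0%N) ->
  (forall (i j : 'I_D.+1) v,
     let XS := flag (fun h : 'I_D.+1 => Estar e C x h) in
     let YS := flag (E \o s) in
     v \in (XS i.+1 :&: YS j.+1)%VS ->
     orth (XS i :&: YS j.+1 + XS i.+1 :&: YS j)%VS v ->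
     M *m v = lam (i + j)%N *: v) ->
  M^T = M.
Proof.
move=> resF p0 MW.
have resX := Estar_resolution e C x.
have [th thE] := dual_mx_eigen x E_prim o.
have [ph phE] := prim_eigen e_sym e_conn e_dr E_prim (memv_dist_mx C o).
apply: (@split_eigen_symmetric _ _ (dist_mx e C 1) (dual_mx x E o)
  (flag (fun h : 'I_D.+1 => Estar e C x h)) (flag (E \o s))
  (flag_proj (fun h : 'I_D.+1 => Estar e C x h)) (flag_proj (E \o s))
  _ _ _ _ _ _ _ _ _ _ _ _ _ _ D.+1 _ _ M lam).
- exact: flag0.
- exact: flag0.
- exact: flagS.
- exact: flagS.
- exact: flagP.
- exact: flagP.
- exact: flag_proj_real_symmetric.
- exact: flag_proj_real_symmetric.
- by move=> i v; apply: flag_raise => // h j; apply: Estar_raise.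
- move=> j v; apply: flag_raise => // h k lt.
  by apply: (dual_mx_triple x e_sym e_conn e_dr E_prim E_kr krE); apply: p0.
- by move=> i; apply: flag_lower thE.
- move=> j; apply: (@flag_lower _ _ _ _ resF _ (ph \o s)) => h; exact: phE.
- move=> S BS i; apply: flag_stable => h.
  exact: (dual_mx_stable e_sym e_conn e_dr E_prim E_kr krE (o := o) erefl BS).
- by move=> S AS j; apply: flag_stable => h; apply: prim_stable.
- exact: flag_full.
- exact: flag_full.
move=> i j v lti ltj; exact: (MW (Ordinal lti) (Ordinal ltj)).
Qed.


End SplitOperator.

Theorem theorem7p3 (R : realType) (X : finType) (e : rel X)
    (b beta q : R[i])
    (E : 'I_(diameter e).+1 -> 'M[R[i]]_#|X|)
    (kr : 'I_(diameter e).+1 -> 'I_(diameter e).+1 -> 'I_(diameter e).+1 -> R[i])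
    (x : X) (Phi Psi : 'M[R[i]]_#|X|) :
  simple_graph e ->
  connected_graph e ->
  distance_regular e ->
  (3 <= diameter e)%N ->
  b != 1 ->
  classical_parameters e (diameter e) b (b - 1) beta ->
  q ^+ 2 = b ->
  primitive_idempotent_ordering E ->
  krein_parameters E kr ->
  (forall h i j, kr h i j = (intersection_number e h i j)%:R) ->
  acts_on_split e (Vdd x E) q Phi ->
  acts_on_split e (Vdu x E) q Psi ->
  Phi^T = Phi /\ Psi^T = Psi.
Proof.
move=> [e_sym _] e_conn e_dr D_ge3 _ _ _ E_prim E_kr krE PhiE PsiE.
have D_gt0 : (0 < diameter e)%N by apply: leq_trans D_ge3.
(* The eigenvalue depends on [i + j] alone, as [split_operator_symmetric] requires. *)
pose lam (n : nat) := q ^ (n%:Z - (diameter e)%:Z).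
have resE := prim_resolution e_sym e_conn e_dr E_prim.
split.
  apply: (split_operator_symmetric (s := id) (lam := lam)
    e_sym e_conn e_dr (D_gt0 := D_gt0) E_prim E_kr krE resE).
    by move=> h j lt; apply: intersection_number0 => //=; lia.
  move=> i j v; exact: (orth_acts (Vdd_flag x E) PhiE).
apply: (split_operator_symmetric (s := @rev_ord _) (lam := lam)
  e_sym e_conn e_dr (D_gt0 := D_gt0) E_prim E_kr krE (resolution_rev resE)).
  (* Reversal preserves the difference of two indices in absolute value, so the triangle inequality
     with side 1 still fails. *)
  move=> h j lt; apply: intersection_number0 => //=.
  by have := ltn_ord h; lia.
move=> i j v; exact: (orth_acts (Vdu_flag x E) PsiE).
Qed.
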